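(* For every integer $k\ge 0$, the $k$th classical numerator $G_k$ and denominator $H_k$ of the continued fraction $$\cfrac{-1}{1+b_1+\cfrac{-1}{1+b_2+\cfrac{-1}{1+b_3+\cdots}}}$$ in noncommuting indeterminates $b_1,b_2,\dots$ are $$G_k=-\sigma(k)+\sum_{m \in \mathcal{V}_{k-1}} (-1)^{g_{k-1}(m)}\, m+\sum_{m \in \mathcal{V}_k} (-1)^{g_k(m)}\, m,$$ and $$H_k=\sigma(k+1)-\sum_{\substack{m\in \mathcal{V}_k \\ \lambda_\ell>1}} (-1)^{g_{k}(m)}\phi(m)-\sum_{\substack{m\in \mathcal{V}_{k+1}\\ \lambda_\ell>1}} (-1)^{g_{k+1}(m)} \phi(m),$$ where in the sums for $H_k$, $\lambda_\ell$ is the last (smallest) component of the index of $m$.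
   Context: The classical numerators and denominators are the polynomials with integer coefficients in the noncommuting indeterminates $b_1,b_2,\dots$ defined by $G_0=0$, $G_1=-1$, $H_0=1$, $H_1=1+b_1$, and $X_k=-X_{k-2}+(1+b_k)X_{k-1}$ for $k\ge2$, for both $X=G$ and $X=H$. For an integer $k\ge -1$, $\mathcal{V}_k$ is the set of monomials $m=b_{\lambda_1}b_{\lambda_2}\cdots b_{\lambda_\ell}$, $\ell\ge 1$, whose index $[\lambda_1,\dots,\lambda_\ell]$ satisfies: (V1) $k\ge\lambda_1>\lambda_2>\dots>\lambda_\ell\ge2$; (V2) $\lambda_1\equiv k\pmod 3$; (V3) $\lambda_j\not\equiv\lambda_{j+1}\pmod 3$ for $1\le j<\ell$; (V4) $\lambda_\ell\not\equiv 1\pmod 3$. For $m\in\mathcal{V}_k$ with index $[\lambda_1,\dots,\lambda_\ell]$, $g_k(m)$ is the maximum number of pairwise disjoint sets of three consecutive integers whose union is a subset of $\{-1,0,1,\dots,k\}\setminus\{\lambda_1,\dots,\lambda_\ell\}$. $\sigma(k)=\frac{2\sqrt3}{3}\sin\left(\frac{k\pi}{3}\right)$, the 6-periodic sequence $0,1,1,0,-1,-1,\dots$ for $k=0,1,2,\dots$. $\phi$ is the substitution ring homomorphism with $\phi(b_1)=0$ and $\phi(b_j)=b_{j-1}$ for $j>1$. *)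

(* Defs.v *)
From HB Require Import structures.
From mathcomp Require Import all_boot all_order all_algebra finmap.
From mathcomp Require Import boolp classical_sets functions cardinality fsbigop.
From mathcomp Require Import reals trigo.
From mathcomp.multinomials Require Import monalg.
From mathcomp Require Import ring lra zify.

Set Implicit Arguments.
Unset Strict Implicit.
Unset Printing Implicit Defensive.

Import Order.TTheory GRing.Theory Num.Theory.

Local Open Scope classical_set_scope.
Local Open Scope ring_scope.

(* The monoid of words is freely generated by b_1, b_2, ...; the letter i : nat
   stands for the indeterminate b_(i+1), so that there is no spurious b_0. *)
Notation monomial := {fmonom nat}.
Notation ncpoly := {malg int[monomial]}.

(* b_j is meant for j >= 1 only. *)
Definition b (j : nat) : ncpoly := << fmu j.-1 >>.

Definition mindex (m : monomial) : seq nat := [seq i.+1 | i <- (m : seq nat)].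

Lemma monomialE (m : monomial) : << m >> = \prod_(j <- mindex m) b j.
Proof.
case: m => s; rewrite /mindex big_map /=; elim: s => [|i s IHs].
  by rewrite big_nil; congr (<< _ >>); apply/eqP; rewrite fmP fm1.
rewrite big_cons -IHs /b /= malgM_def fgmulUU mulr1; congr (<< _ >>).
by apply/eqP; rewrite fmP fmM fmU.
Qed.

(* Indeterminates do not commute: the partial denominators 1 + b_k of the
   continued fraction, whose partial numerators are all -1, act on the left. *)
Fixpoint three_term (X0 X1 : ncpoly) (k : nat) : ncpoly :=
  match k with
  | 0 => X0
  | 1 => X1
  | (k'.+1 as k1).+1 =>
      - three_term X0 X1 k' + (1 + b k'.+2) * three_term X0 X1 k1
  end.

Definition G : nat -> ncpoly := three_term 0 (-1).
Definition H : nat -> ncpoly := three_term 1 (1 + b 1).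

Definition V (k : int) : set monomial :=
  [set m | let l := mindex m in
    l != [::] /\
    [/\ [&& (head 0%N l)%:Z <= k, sorted gtn l & (2 <= last 0%N l)%N],
        (head 0%N l = k %[mod 3])%Z,
        sorted (fun x y => x != y %[mod 3])%N l &
        (last 0 l != 1 %[mod 3])%N]].

(* {-1, 0, ..., k} minus the components of the index of m, for k >= -1:
   see mem_gaps. *)
Definition gaps (k : int) (m : monomial) : {fset int} :=
  [fset i | i in [seq (n%:Z - 1)%R | n <- iota 0 (absz (k + 2)%R)]
          & i \notin [seq j%:Z | j <- mindex m]]%fset.

Definition is_triple (B : {fset int}) : Prop :=
  exists a : int, B = [fset a; (a + 1)%R; (a + 2)%R]%fset.

(* trivIfset F says that the members of F are pairwise disjoint. *)
Definition triple_packing (S : {fset int}) (F : {fset {fset int}}) : bool :=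
  [&& all (fun B => `[< is_triple B >]) F, trivIfset F & fcover F `<=` S]%fset.

Definition g (k : int) (m : monomial) : nat :=
  \max_(F <- fpowerset (fpowerset (gaps k m)) | triple_packing (gaps k m) F)
    #|` F|.

Definition sigma_real (R : realType) (k : nat) : R :=
  2 * Num.sqrt 3 / 3 * sin (k%:R * pi / 3).

(* sigma_real takes integer values (lemma sigmaE), so that the rounding only
   changes the type. *)
Definition sigma (R : realType) (k : nat) : int := Num.floor (sigma_real R k).

(* phi b_(i+1), in the encoding of letters above *)
Definition phi_letter (i : nat) : ncpoly := if i is j.+1 then << fmu j >> else 0.
Definition phi_monomial (m : monomial) : ncpoly :=
  \prod_(i <- (m : seq nat)) phi_letter i.

Definition phi : ncpoly -> ncpoly := mmap intr phi_monomial.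

Lemma cos_pi3 (R : realType) : cos (pi / 3) = 2^-1 :> R.
Proof.
set x : R := pi / 3.
have x3 : x *+ 2 = pi - x by rewrite /x; field.
have c2 : cos (x *+ 2) = - cos x.
  by rewrite x3 cosB cospi sinpi; ring.
have c0 : 0 < cos x.
  apply: cos_gt0_pihalf; have := pi_gt0 R; rewrite /x => ?; apply/andP; split; lra.
move: c2; rewrite cos_mulr2n => c2; nra.
Qed.

Lemma sin_pi3 (R : realType) : sin (pi / 3) = Num.sqrt 3 / 2 :> R.
Proof.
have s0 : 0 < sin (pi / 3) :> R.
  apply: sin_gt0_pi; have := pi_gt0 R => ?; apply/andP; split; lra.
have := cos2Dsin2 (pi / 3 : R); rewrite cos_pi3 => e.
have q := @sqr_sqrtr R 3 ltac:(lra).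
have q0 : 0 <= Num.sqrt 3 :> R by exact: sqrtr_ge0.
apply/eqP; rewrite -(eqrXn2 (n := 2)) //; [apply/eqP; rewrite expr_div_n q; nra|exact: ltW|].
by apply: divr_ge0.
Qed.

Lemma sigma_real_int (R : realType) (k : nat) :
  {z : int * int | (sigma_real R k = z.1%:~R) /\ (sigma_real R k.+1 = z.2%:~R)}.
Proof.
have q := @sqr_sqrtr R 3 ltac:(lra).
elim: k => [|k [[u v] /= [eu ev]]].
  exists (0, 1); rewrite /sigma_real /=; split; first by rewrite !mul0r sin0 mulr0.
  rewrite mul1r sin_pi3.
  have -> : 2 * Num.sqrt 3 / 3 * (Num.sqrt 3 / 2) = Num.sqrt 3 ^+ 2 / 3 :> R by field.
  by rewrite q divff ?pnatr_eq0.
exists (v, v - u); split=> //=; rewrite intrB -eu -ev /sigma_real.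
set x := k.+1%:R * pi / 3.
have -> : k.+2%:R * pi / 3 = x + pi / 3 :> R by rewrite /x -(natr1 k.+1); field.
have -> : k%:R * pi / 3 = x - pi / 3 :> R by rewrite /x -(natr1 k); field.
by rewrite sinD sinB cos_pi3; field.
Qed.

Lemma sigmaE (R : realType) (k : nat) : (sigma R k)%:~R = sigma_real R k.
Proof. by rewrite /sigma; case: (sigma_real_int R k) => z [-> _]; rewrite intrKfloor. Qed.

Lemma phi_monomial_is_multiplicative : mmorphism phi_monomial.
Proof.
by split=> [x y|]; rewrite /phi_monomial ?fmM ?big_cat// fm1 big_nil.
Qed.
HB.instance Definition _ := isMultiplicative.Build monomial ncpoly phi_monomial
  phi_monomial_is_multiplicative.

HB.instance Definition _ := GRing.Additive.copy phi (mmap intr phi_monomial).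

Lemma phi_is_multiplicative : multiplicative phi.
Proof.
by apply: commr_mmap_is_multiplicative => p m m'; apply/commr_sym/commr_int.
Qed.
HB.instance Definition _ := GRing.isMultiplicative.Build ncpoly ncpoly phi
  phi_is_multiplicative.

Lemma phi_b1 : phi (b 1) = 0.
Proof. by rewrite /phi /b mmapU /phi_monomial /= fmU big_seq1 mulr0. Qed.

Lemma phi_b (j : nat) : (1 < j)%N -> phi (b j) = b j.-1.
Proof.
by case: j => [|[|j]] // _; rewrite /phi /b mmapU /phi_monomial fmU big_seq1 mul1r.
Qed.

Lemma finite_V (k : int) : finite_set (V k).
Proof.
pose L := rev (iota 0 `|k|%N).
apply: (@sub_finite_set _ _
  ((fun t : (size L).-tuple bool => FMonom (mask t L)) @` setT)); last first.
  exact/finite_image/finite_finset.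
move=> [s] /=; rewrite /V /mindex /= => -[s0 [/and3P[hd srt _] _ _ _]].
have sg : sorted gtn s.
  by move: srt; rewrite sorted_map; apply: sub_sorted => x y /=; rewrite ltnS.
have gt : transitive gtn by move=> x y z /= h1 h2; apply: ltn_trans h2 h1.
exists (map_tuple (mem s) (in_tuple L)) => //; congr FMonom => /=.
rewrite -filter_mask; apply: (irr_sorted_eq gt) => //.
- by move=> x /=; rewrite ltnn.
- by apply: sorted_filter => //; rewrite rev_sorted iota_ltn_sorted.
move=> x; rewrite mem_filter andb_idr // => xs; rewrite mem_rev mem_iota /= add0n.
case: s s0 hd srt sg xs => // y s _ /= hd _ sg; rewrite inE.
have ys : all (gtn y) s by exact: (order_path_min gt).
by move=> /predU1P[->|/(allP ys) /= ?]; lia.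
Qed.

Lemma mem_gaps (k i : int) (m : monomial) : -1 <= k ->
  (i \in gaps k m) = (-1 <= i <= k) && (i \notin [seq j%:Z | j <- mindex m]).
Proof.
move=> k1; rewrite /gaps !inE /=; congr (_ && _); apply/mapP/idP.
  by move=> [n]; rewrite mem_iota => ? ->; lia.
by move=> ?; exists (absz (i + 1)); rewrite ?mem_iota; lia.
Qed.

(* Main.v *)
Require Import Defs.
From HB Require Import structures.
From mathcomp Require Import all_boot all_order all_algebra finmap.
From mathcomp Require Import boolp classical_sets functions cardinality fsbigop.
From mathcomp Require Import reals trigo.
From mathcomp.multinomials Require Import monalg.
From mathcomp Require Import ring lra zify ssrAC.

(** Write S_k for the sum of (-1)^(g_k(m)) m over V_k, so that G_k should be
    - sigma(k) + S_(k-1) + S_k.  The heart of the proof is the recurrence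

      S_k = - S_(k-3) + b_k (S_(k-1) + S_(k-2) - sigma(k-1))      (k >= 2),

    because, once G_(k-1) = - sigma(k-1) + S_(k-2) + S_(k-1) is known, it reads
    S_k + S_(k-3) = b_k G_(k-1); the terms S_(k-1) and S_(k-2) telescope in
    G_k - G_(k-1) + G_(k-2), and sigma(k) - sigma(k-1) + sigma(k-2) = 0.

    The recurrence ([V_sum_rec]) comes from splitting V_k on the first letter
    of a monomial ([V_rec]).  Either the first index is at most k - 3, and the
    monomial lies in V_(k-3); or it is k, and what remains is a member of
    V_(k-1), a member of V_(k-2), or the empty word, the last one only when
    k is not 1 mod 3.  The signs follow from three facts on packings of triples
    of consecutive integers:
    - passing from k - 3 to k adds a whole triple above everything else, which
      raises the maximum by exactly one ([g_add3]);
    - removing the first letter b_k does not change the gaps below k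
      ([g_cons]);
    - for m in V_k, the gap above the first index of m has a length divisible
      by 3, so that one more integer on top of it completes no triple:
      g_(k+1)(m) = g_k(m) ([g_succ]).
    The empty word contributes - sigma(k-1), both quantities changing sign when
    k grows by 3 ([constant_termE]).

    For the denominators, phi shifts the recurrence of G onto that of H, hence
    H_k = - phi(G_(k+1)) ([denominatorE]). *)

Set Implicit Arguments.
Unset Strict Implicit.
Unset Printing Implicit Defensive.

Import Order.TTheory GRing.Theory Num.Theory.

Local Open Scope classical_set_scope.
Local Open Scope ring_scope.

(** * Packings of triples of consecutive integers *)

Definition triple (a : int) : {fset int} := [fset a; (a + 1)%R; (a + 2)%R]%fset.

Definition max_packing (S : {fset int}) : nat :=
  \max_(F <- fpowerset (fpowerset S) | triple_packing S F) #|` F|.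

Lemma in_triple (a i : int) : (i \in triple a) = (a <= i <= a + 2).
Proof. by rewrite !inE; lia. Qed.

Lemma triple_packingP (S : {fset int}) (F : {fset {fset int}}) :
  reflect ((forall B, B \in F ->
              exists a, B = triple a /\ (triple a `<=` S)%fset)
           /\ trivIfset F)
          (triple_packing S F).
Proof.
apply: (iffP and3P) => [[/allP tF dF /bigfcupsP cF]|[tF dF]]; split=> //.
- move=> B BF; have /asboolP[a eB] := tF B BF; exists a.
  by rewrite /triple -eB cF.
- by apply/allP => B /tF[a [-> _]]; apply/asboolP; exists a.
- by apply/bigfcupsP => B BF _; have [a [-> ]] := tF B BF.
Qed.

Lemma max_packing_le (S : {fset int}) (n : nat) :
  (forall F, triple_packing S F -> (#|` F| <= n)%N) -> (max_packing S <= n)%N.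
Proof.
move=> leF; rewrite /max_packing big_seq_cond.
by apply/bigmax_leqP_seq => F _ /andP[_ /leF].
Qed.

Lemma card_le_max_packing (S : {fset int}) (F : {fset {fset int}}) :
  triple_packing S F -> (#|` F| <= max_packing S)%N.
Proof.
move=> pF; rewrite /max_packing; apply: (leq_bigmax_seq _ _ pF).
rewrite fpowersetE; apply/fsubsetP => B BF; rewrite fpowersetE.
by have /triple_packingP[/(_ B BF)[a [-> ]]] := pF.
Qed.

(** A triple through [a] would also contain [a - 1] or [a + 1], so the packings
    of the two sets are the same. *)
Lemma max_packing_add_isolated (S : {fset int}) (a : int) :
  (forall i, i \in S -> i < a - 1) ->
  max_packing (a |` S)%fset = max_packing S.
Proof.
move=> ltS; apply/eqP; rewrite eqn_leq; apply/andP.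
split; apply: max_packing_le => F.
  move=> /triple_packingP[tF dF]; apply: card_le_max_packing.
  apply/triple_packingP; split=> // B /tF[c [-> /fsubsetP sub]].
  exists c; split=> //.
  have mem j : c <= j <= c + 2 -> (j == a) || (j \in S).
    by rewrite -in_triple => /sub; rewrite !inE.
  apply/fsubsetP => i; rewrite in_triple => ci.
  have := mem i ci; case/orP => // /eqP ia.
  have /orP[/eqP c1|/ltS] := mem (c + 1) ltac:(lia); last by lia.
  by have /orP[|/ltS] := mem c ltac:(lia); lia.
move=> /triple_packingP[tF dF]; apply: card_le_max_packing.
apply/triple_packingP; split=> // B /tF[c [-> sub]]; exists c; split=> //.
by apply: fsubset_trans sub _; apply: fsubsetU1.
Qed.

(** A triple of [S `|` triple a] that meets [triple a] contains [a], since [S]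
    lies below [a].  So a packing has at most one such member, and deleting it
    leaves a packing of [S]. *)
Lemma max_packing_add_triple (S : {fset int}) (a : int) :
  (forall i, i \in S -> i < a) ->
  max_packing (S `|` triple a)%fset = (max_packing S).+1.
Proof.
move=> ltS; apply/eqP; rewrite eqn_leq; apply/andP; split.
  apply: max_packing_le => F /triple_packingP[tF /trivIfsetP dF].
  have below (F' : {fset {fset int}}) : (F' `<=` F)%fset ->
      (forall B, B \in F' -> a \notin B) -> (#|` F'| <= max_packing S)%N.
    move=> /fsubsetP sF aF; apply: card_le_max_packing; apply/triple_packingP.
    split; last by apply/trivIfsetP => B C /sF BF /sF CF; apply: dF.
    move=> B BF; have [c [eB /fsubsetP sub]] := tF B (sF _ BF).
    exists c; split=> //; have := aF B BF; rewrite eB in_triple => ac.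
    have mem j : c <= j <= c + 2 -> (j \in S) || (a <= j <= a + 2).
      by rewrite -!in_triple => /sub; rewrite in_fsetU.
    have c2 : c + 2 < a.
      have := mem (c + 2) ltac:(lia); case/orP => [/ltS //|]; lia.
    apply/fsubsetP => i; rewrite in_triple => ci.
    by have := mem i ci; case/orP => //; lia.
  have [[B BF aB]|aF] := pselect (exists2 B, B \in F & a \in B); last first.
    by apply/leqW/below => // B BF; apply/negP => aB; apply: aF; exists B.
  rewrite (cardfsD1 B) BF add1n ltnS; apply: below; first exact: fsubD1set.
  move=> C; rewrite !inE => /andP[CB CF]; apply/negP => aC.
  by have /fdisjointP/(_ a aC) := dF _ _ CF BF CB; rewrite aB.
have add F : triple_packing S F ->
    (#|` F|.+1 <= max_packing (S `|` triple a)%fset)%N.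
  move=> /triple_packingP[tF /trivIfsetP dF].
  have dT B : B \in F -> [disjoint B & triple a]%fset.
    move=> /tF[c [-> /fsubsetP sub]]; apply/fdisjointP => i /sub /ltS.
    by rewrite in_triple; lia.
  have TF : triple a \notin F.
    by apply/negP => /dT /fdisjointP /(_ a); rewrite in_triple; lia.
  have -> : #|` F|.+1 = #|` triple a |` F|%fset by rewrite cardfsU1 TF.
  apply: card_le_max_packing; apply/triple_packingP; split.
    move=> B; rewrite !inE => /predU1P[->|/tF[c [-> sub]]].
      by exists a; split=> //; apply: fsubsetUr.
    by exists c; split=> //; apply: fsubset_trans sub _; apply: fsubsetUl.
  apply/trivIfsetP => B C; rewrite !inE.
  move=> /predU1P[->|BF] /predU1P[->|CF] neq.
  - by rewrite eqxx in neq.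
  - by rewrite fdisjoint_sym dT.
  - exact: dT.
  - exact: dF.
have F0 : triple_packing S fset0.
  by apply/triple_packingP; split=> //; apply/trivIfsetP.
have pos := add _ F0.
by rewrite -ltnS -(prednK pos) ltnS; apply: max_packing_le => F /add; lia.
Qed.

Lemma max_packing0 : max_packing fset0 = 0%N.
Proof.
apply/eqP; rewrite -leqn0; apply: max_packing_le => F /triple_packingP[tF _].
rewrite leqn0 cardfs_eq0; apply/eqP/fsetP => B; rewrite in_fset0.
apply/negP => /tF[a [_ /fsubsetP/(_ a)]]; rewrite in_triple in_fset0; lia.
Qed.

(** * Gaps of a monomial *)

Lemma gE (k : int) (m : monomial) : g k m = max_packing (gaps k m).
Proof. by []. Qed.

(** As [fmu i] is the indeterminate b_(i+1), this is b_(i+1) m. *)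
Definition cons_letter (i : nat) (m : monomial) : monomial := mmul (fmu i) m.

Lemma mindex_cons (i : nat) (m : monomial) :
  mindex (cons_letter i m) = i.+1 :: mindex m.
Proof. by rewrite /mindex fmM fmU. Qed.

Lemma mindex1 : mindex (mone : monomial) = [::].
Proof. by rewrite /mindex fm1. Qed.

Lemma mem_gaps_nat (k i : int) (m : monomial) : -1 <= k ->
  (i \in gaps k m) = (-1 <= i <= k) && ~~ ((0 <= i) && (absz i \in mindex m)).
Proof.
move=> k1; rewrite mem_gaps //; congr (_ && ~~ _); apply/mapP/andP.
  by move=> [j jm ->].
by move=> [i0 im]; exists (absz i) => //; lia.
Qed.

(** The new gaps k + 1, k + 2 and k + 3 form a triple above all the others. *)
Lemma g_add3 (k : int) (m : monomial) : -1 <= k ->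
  (forall j, j \in mindex m -> j%:Z <= k) -> g (k + 3) m = (g k m).+1.
Proof.
move=> k1 lem; rewrite -[RHS](max_packing_add_triple (a := k + 1)); last first.
  by move=> i; rewrite mem_gaps_nat //; lia.
congr max_packing; apply/fsetP => i.
rewrite in_fsetU in_triple !mem_gaps_nat //; last by lia.
have [i0|] := leP 0 i; last by lia.
by have [/lem|] := boolP (absz i \in mindex m); lia.
Qed.

Lemma g_cons (i : nat) (m : monomial) : g i.+1%:Z (cons_letter i m) = g i%:Z m.
Proof.
congr max_packing; apply/fsetP => j.
rewrite !mem_gaps_nat // mindex_cons in_cons.
have [->|neq] := eqVneq j i.+1%:Z; first by rewrite eqxx; lia.
by case: (_ \in mindex m); lia.
Qed.

(** * The sets V_k *)

Lemma V_le (k : int) (m : monomial) (j : nat) :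
  V k m -> j \in mindex m -> j%:Z <= k.
Proof.
move=> [_ [/and3P[hd srt _] _ _ _]]; move: hd srt.
case: (mindex m) => //= h l hd srt; rewrite inE => /predU1P[->//|jl].
have gt : transitive gtn by move=> x y z /= h1 h2; apply: ltn_trans h2 h1.
by have /allP/(_ j jl) /= := order_path_min gt srt; lia.
Qed.

Lemma V_gt1 (k : int) (m : monomial) : V k m -> (1 < last 0 (mindex m))%N.
Proof. by move=> [_ [/and3P[]]]. Qed.

Lemma V_head (k : int) (m : monomial) : V k m ->
  [/\ head 0%N (mindex m) \in mindex m, (2 <= head 0%N (mindex m))%N
    & (head 0%N (mindex m) = k %[mod 3])%Z].
Proof.
move=> Vm; have [ne [/and3P[_ _ lst] hk _ _]] := Vm.
have hm : head 0%N (mindex m) \in mindex m.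
  by case: (mindex m) ne => //= h l _; rewrite mem_head.
split=> //; case: Vm => _ [/and3P[_ + _] _ _ _]; move: lst.
case: (mindex m) ne => // h l _ /= lst srt.
have gt : transitive gtn by move=> x y z /= h1 h2; apply: ltn_trans h2 h1.
have := mem_last h l; rewrite inE => /predU1P[<-//|ll].
by have /allP/(_ _ ll) /= := order_path_min gt srt; lia.
Qed.

Lemma V_sub3 (k : int) (m : monomial) :
  V (k - 3) m <-> V k m /\ head 0%N (mindex m) != k :> int.
Proof.
rewrite /V /=; set h := head _ _; split.
  move=> [ne [/and3P[? -> ->] ? -> ->]]; split; last by lia.
  by split=> //; split=> //; lia.
move=> [[ne [/and3P[? -> ->] ? -> ->]] neq]; split=> //; split=> //; lia.
Qed.

(** When the first index is [k], the new integer [k + 1] is isolated from the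
    other gaps.  When it is at most [k - 3], a triple can be removed on top of
    both gap sets, which reduces the claim to [k - 3]. *)
Lemma g_succ (k : nat) (m : monomial) : V k%:Z m -> g k.+1%:Z m = g k%:Z m.
Proof.
elim/ltn_ind: k => k IHk Vm.
have [hm h2 h3] := V_head Vm; have hk := V_le Vm hm.
have [eh|neq] := eqVneq (head 0%N (mindex m))%:Z k%:Z.
  rewrite !gE -(@max_packing_add_isolated (gaps k%:Z m) k.+1%:Z); last first.
    move=> i; rewrite mem_gaps_nat // => /andP[ik nim].
    have [ei|nei] := eqVneq i k%:Z; last by lia.
    by move: nim; rewrite ei -eh /= hm.
  congr max_packing; apply/fsetP => i; rewrite in_fset1U !mem_gaps_nat //.
  have [->|] := eqVneq i k.+1%:Z; last by lia.
  by have [/(V_le Vm)|] := boolP (absz k.+1%:Z \in mindex m); lia.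
have Vm' : V (k%:Z - 3) m by apply/V_sub3.
have [k' ek] : exists k', k = k'.+3 by exists (k - 3)%N; lia.
subst k; have eV : k'.+3%:Z - 3 = k'%:Z by lia.
rewrite eV in Vm'.
have -> : k'.+4%:Z = k'.+1%:Z + 3 by lia.
have -> : k'.+3%:Z = k'%:Z + 3 by lia.
have le_m j : j \in mindex m -> j%:Z <= k'%:Z by exact: V_le.
rewrite g_add3 //; last by move=> j /le_m; lia.
by rewrite g_add3 // (IHk k') //; lia.
Qed.

(** The second index is at most [i] and not congruent to [i + 1] mod 3, so it is
    congruent to [i] or to [i - 1]: this decides between the two sets. *)
Lemma V_cons (i : nat) (m : monomial) : m != mone ->
  V i.+1%:Z (cons_letter i m) <-> V i%:Z m \/ V (i%:Z - 1) m.
Proof.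
rewrite -(inj_eq val_inj) /= fm1 /V /= mindex_cons.
have -> : (fmonom_val m == [::]) = (mindex m == [::]).
  by rewrite /mindex; case: (fmonom_val m).
case: (mindex m) => //= h l _; split.
  move=> [_ [/and3P[_ /andP[lt_h ->] ->] _ /andP[neq ->] ->]].
  have [eh|neh] := eqVneq (h %% 3)%N (i %% 3)%N; [left|right].
    by split=> //; split=> //; lia.
  by split=> //; split=> //; lia.
by move=> [] [_ [/and3P[le_h -> ->] eq_h -> ->]]; split=> //; split=> //; lia.
Qed.

Lemma V_letter (i : nat) :
  V i.+2%:Z (cons_letter i.+1 mone) <-> (i %% 3 != 2)%N.
Proof.
rewrite /V /= mindex_cons mindex1 /=; split=> [[_ [_ _ _]]|]; first by lia.
by move=> ?; split=> //; split=> //; lia.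
Qed.

(** What may follow the letter b_(n+2) at the head of a member of V_(n+2); the
    empty word may do so when the index n + 2 is not 1 mod 3. *)
Definition V_tails (n : nat) : set monomial :=
  V n.+1%:Z `|` V n%:Z `|` [set m | m = mone /\ (n %% 3 != 2)%N].

Lemma V_rec (n : nat) :
  V n.+2%:Z = V (n%:Z - 1) `|` cons_letter n.+1 @` V_tails n.
Proof.
have en : n%:Z - 1 = n.+2%:Z - 3 by lia.
have em : n.+1%:Z - 1 = n%:Z by lia.
apply/seteqP; split=> m; last first.
  move=> [|[t Vt <-]]; first by rewrite en => /V_sub3[].
  have [t1|t1] := eqVneq t mone.
    move: Vt; rewrite /V_tails t1 /= => -[[|]|[_ ?]]; last exact/V_letter.
    - by move=> [] /=; rewrite mindex1.
    - by move=> [] /=; rewrite mindex1.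
  apply/V_cons => //; rewrite em; case: Vt => [//|[te]].
  by rewrite te eqxx in t1.
move=> Vm.
have [ehd|neq] := eqVneq (head 0%N (mindex m))%:Z n.+2%:Z; last first.
  by left; rewrite en; apply/V_sub3.
right.
have [t et] : exists t, m = cons_letter n.+1 t.
  case: m ehd Vm => -[|h s]; first by rewrite /mindex.
  rewrite /mindex /= => -[->] _; exists (FMonom s).
  by apply/eqP; rewrite fmP fmM fmU.
exists t => //; rewrite et in Vm.
have [t1|t1] := eqVneq t mone.
  by right; split=> //; rewrite t1 in Vm; apply/V_letter.
by left; move/(V_cons _ t1): Vm; rewrite em.
Qed.

(** * Signed sums over V_k *)

Definition V_sum (k : int) : ncpoly :=
  \sum_(m \in V k) (-1) ^+ g k m *: (<< m >> : ncpoly).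

Lemma malg_cons (i : nat) (m : monomial) :
  << cons_letter i m >> = b i.+1 * << m >> :> ncpoly.
Proof. by rewrite /b malgM_def fgmulUU mulr1. Qed.

Lemma cons_letter_inj (i : nat) : injective (cons_letter i).
Proof.
move=> m m' /(congr1 (@fmonom_val _)); rewrite !fmM !fmU => -[em].
exact: val_inj.
Qed.

Lemma V_sum_small (k : int) : k < 2 -> V_sum k = 0.
Proof.
move=> k2; apply: fsbig1 => m Vm.
by have [hm] := V_head Vm; have := V_le Vm hm; lia.
Qed.

(** The signed contribution of the empty word to the sum over [V_tails n]. *)
Definition constant_term (n : nat) : int :=
  if (n %% 3 == 2)%N then 0 else (-1) ^+ g n.+1%:Z mone.

Lemma finite_V_tails (n : nat) : finite_set (V_tails n).
Proof.
rewrite /V_tails !finite_setU; split; first by split; apply: finite_V.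
by apply: (@sub_finite_set _ _ [set mone]) => // m [].
Qed.

Lemma fsum_V_tails (n : nat) :
  \sum_(m \in V_tails n) (-1) ^+ g n.+1%:Z m *: (<< m >> : ncpoly)
  = V_sum n.+1%:Z + V_sum n%:Z + (constant_term n)%:MP.
Proof.
have [[fin1 fin2] fin3] : (finite_set (V n.+1%:Z) /\ finite_set (V n%:Z)) /\
    finite_set [set m : monomial | m = mone /\ (n %% 3 != 2)%N].
  by have := finite_V_tails n; rewrite !finite_setU.
rewrite /V_tails fsbigU0 //=; first last.
- by move=> m [+ [m1 _]]; rewrite m1 => -[] []; rewrite mindex1.
- by rewrite finite_setU.
rewrite fsbigU0 //=; last first.
  by move=> m [/V_head[_ _ e] /V_head[_ _ e']]; lia.
have -> : \sum_(m \in V n%:Z) (-1) ^+ g n.+1%:Z m *: (<< m >> : ncpoly)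
    = V_sum n%:Z.
  by apply: eq_fsbigr => m; rewrite inE => /g_succ ->.
set c := (X in _ + _ + X = _); suff -> : c = (constant_term n)%:MP by [].
rewrite /c /constant_term; case: ifP => n3.
  rewrite malgC0E (_ : [set _ | _] = set0) ?fsbig_set0 //.
  by apply/seteqP; split=> // m [].
rewrite (_ : [set _ | _] = [set mone]) ?fsbig_set1; last first.
  by apply/seteqP; split=> [m []|m ->].
by rewrite -mul_malgC mulr1.
Qed.

Lemma raddf_fsum (U W : zmodType) (f : {additive U -> W}) (I : choiceType)
    (A : set I) (F : I -> U) : finite_set A ->
  f (\sum_(i \in A) F i) = \sum_(i \in A) f (F i).
Proof. by move=> finA; rewrite !fsbig_finite //= raddf_sum. Qed.

Lemma fsum_add3 (k : int) : -1 <= k ->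
  \sum_(m \in V k) (-1) ^+ g (k + 3) m *: (<< m >> : ncpoly) = - V_sum k.
Proof.
move=> k1; rewrite /V_sum (raddf_fsum (@GRing.opp ncpoly)); last first.
  exact: finite_V.
apply: eq_fsbigr => m /[!inE] Vm.
rewrite g_add3 //; last by move=> j; apply: V_le.
by rewrite exprS mulN1r scaleNr.
Qed.

Lemma fsum_cons (n : nat) :
  \sum_(m \in cons_letter n.+1 @` V_tails n)
    (-1) ^+ g n.+2%:Z m *: (<< m >> : ncpoly)
  = b n.+2 * (V_sum n.+1%:Z + V_sum n%:Z + (constant_term n)%:MP).
Proof.
rewrite fsbig_image; last by move=> m m' _ _; apply: cons_letter_inj.
rewrite -fsum_V_tails fsbig_distrr; last exact: finite_V_tails.
apply: eq_fsbigr => m _; rewrite g_cons malg_cons -signr_odd !scaler_sign.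
by case: odd; rewrite /= ?mulrN.
Qed.

Lemma V_sum_rec (n : nat) :
  V_sum n.+2%:Z
  = - V_sum (n%:Z - 1)
    + b n.+2 * (V_sum n.+1%:Z + V_sum n%:Z + (constant_term n)%:MP).
Proof.
have V_lt m : V (n%:Z - 1) m -> (head 0%N (mindex m))%:Z <= n%:Z - 1.
  by move=> Vm; have [hm _ _] := V_head Vm; have := V_le Vm hm.
rewrite -fsum_cons -fsum_add3; last by lia.
rewrite (_ : n%:Z - 1 + 3 = n.+2%:Z); last by lia.
rewrite {1}/V_sum (V_rec n) fsbigU0 //; first exact: finite_V.
  exact/finite_image/finite_V_tails.
by move=> m [] /[swap] -[t _ <-] /V_lt; rewrite mindex_cons /=; lia.
Qed.

(** * The sequence sigma and the sign of the empty word *)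

Lemma sigma_small (R : realType) : sigma R 0 = 0 /\ sigma R 1 = 1.
Proof.
have q := @sqr_sqrtr R 3 ltac:(lra).
split; apply: (@intr_inj R); rewrite sigmaE /sigma_real.
  by rewrite !mul0r sin0 mulr0.
rewrite mul1r sin_pi3.
have -> : 2 * Num.sqrt 3 / 3 * (Num.sqrt 3 / 2) = Num.sqrt 3 ^+ 2 / 3 :> R.
  by field.
by rewrite q divff ?pnatr_eq0.
Qed.

Lemma sigma_rec (R : realType) (k : nat) :
  sigma R k.+2 = sigma R k.+1 - sigma R k.
Proof.
apply: (@intr_inj R); rewrite intrB !sigmaE /sigma_real.
set x := k.+1%:R * pi / 3.
have -> : k.+2%:R * pi / 3 = x + pi / 3 :> R by rewrite /x -(natr1 k.+1); field.
have -> : k%:R * pi / 3 = x - pi / 3 :> R by rewrite /x -(natr1 k); field.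
by rewrite sinD sinB cos_pi3; field.
Qed.

Lemma g_N1_mone : g (-1) mone = 0%N.
Proof.
rewrite gE -max_packing0 -(@max_packing_add_isolated fset0 (-1)) //.
congr max_packing; apply/fsetP => i.
by rewrite in_fset1U mem_gaps_nat // mindex1 in_fset0 in_nil; lia.
Qed.

Lemma g_1_mone : g 1 mone = 1%N.
Proof.
rewrite gE -max_packing0 -(@max_packing_add_triple fset0 (-1)) //.
congr max_packing; apply/fsetP => i.
by rewrite in_fsetU in_triple mem_gaps_nat // mindex1 in_fset0 in_nil; lia.
Qed.

Lemma constant_term_add3 (n : nat) : constant_term n.+3 = - constant_term n.
Proof.
rewrite /constant_term (_ : n.+3 %% 3 = n %% 3)%N; last by lia.
case: eqP => _; first by rewrite oppr0.
rewrite (_ : n.+4%:Z = n.+1%:Z + 3); last by lia.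
by rewrite g_add3 // ?mindex1 // exprS mulN1r.
Qed.

(** Both sides are antiperiodic with antiperiod 3, which leaves the values at
    0, 1 and 2. *)
Lemma constant_termE (R : realType) (n : nat) :
  constant_term n = - sigma R n.+1.
Proof.
have [s0 s1] := sigma_small R.
have s2 : sigma R 2 = 1 by rewrite sigma_rec s0 s1.
have s3 : sigma R 3 = 0 by rewrite sigma_rec s1 s2.
have sigma_add3 k : sigma R k.+3 = - sigma R k.
  by rewrite !sigma_rec; lia.
have g2 : g 2 mone = 1%N.
  by rewrite (_ : 2 = -1 + 3) // g_add3 ?g_N1_mone // mindex1.
elim/ltn_ind: n => -[|[|[|n]]] IHn.
- by rewrite s1 /constant_term g_1_mone.
- by rewrite s2 /constant_term g2.
- by rewrite s3.
- by rewrite constant_term_add3 sigma_add3 IHn //; lia.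
Qed.

(** * Numerators and denominators *)

Lemma G_rec (k : nat) : G k.+2 = - G k + (1 + b k.+2) * G k.+1.
Proof. by []. Qed.

Lemma H_rec (k : nat) : H k.+2 = - H k + (1 + b k.+2) * H k.+1.
Proof. by []. Qed.

(** The inductive step for the numerators, with [W], [Y], [X] standing for
    S_(k-3), S_(k-2), S_(k-1), [c] for b_k, and [s0], [s1] for the values of
    sigma at k - 2 and k - 1. *)
Lemma recurrence_step (U : nzRingType) (c s0 s1 W X Y G0 G1 : U) :
  G0 = - s0 + W + Y -> G1 = - s1 + Y + X ->
  - G0 + (1 + c) * G1 = - (s1 - s0) + X + (- W + c * (X + Y - s1)).
Proof.
move=> -> ->; have -> : X + Y - s1 = - s1 + Y + X.
  by rewrite addrC (addrC X) addrA.
rewrite mulrDl mul1r; set B := c * _.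
(* The two sides differ only by the cancelling pair - Y + Y on the left. *)
rewrite !opprD !opprK [LHS](AC (3*4) (3*5*1*2*4*6*7))/= addNr add0r.
by rewrite [RHS](AC (2*1*2) (2*4*1*3*5)).
Qed.

Lemma numeratorE (R : realType) (k : nat) :
  G k = - (sigma R k)%:MP + V_sum (k%:Z - 1) + V_sum k%:Z.
Proof.
have [s0 s1] := sigma_small R.
suff [] : G k = - (sigma R k)%:MP + V_sum (k%:Z - 1) + V_sum k%:Z /\
  G k.+1 = - (sigma R k.+1)%:MP + V_sum k%:Z + V_sum k.+1%:Z by [].
elim: k => [|k [IH0 IH1]].
  by rewrite s0 s1 !V_sum_small // malgC0E oppr0 !addr0.
have ek : k.+1%:Z - 1 = k%:Z by lia.
rewrite ek; split; first exact: IH1.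
rewrite G_rec V_sum_rec (constant_termE R) sigma_rec raddfN raddfB.
exact: recurrence_step IH0 IH1.
Qed.

Lemma phi_D : {morph phi : x y / x + y}.
Proof. exact: raddfD. Qed.

Lemma phi_N : {morph phi : x / - x}.
Proof. exact: raddfN. Qed.

Lemma phi_M : {morph phi : x y / x * y}.
Proof. exact: rmorphM. Qed.

Lemma phi_1 : phi 1 = 1.
Proof. exact: rmorph1. Qed.

Lemma phi_partial_denominator (k : nat) : phi (1 + b k.+2) = 1 + b k.+1.
Proof. by rewrite phi_D phi_1 phi_b. Qed.

(** [phi] sends the factor 1 + b_(k+1) in the recurrence of G to 1 + b_k, so
    both sides satisfy the recurrence of H; the initial values agree because
    G_1 = -1 and G_2 = - (1 + b_2). *)
Lemma denominatorE (k : nat) : H k = - phi (G k.+1).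
Proof.
suff [] : H k = - phi (G k.+1) /\ H k.+1 = - phi (G k.+2) by [].
elim: k => [|k [IH0 IH1]].
  have G1 : G 1 = - 1 by [].
  have H1 : H 1 = 1 + b 1 by [].
  have G2 : G 2 = - (1 + b 2).
    by rewrite G_rec G1 mulrN1 (_ : G 0 = 0) // oppr0 add0r.
  split; first by rewrite G1 phi_N phi_1 opprK.
  by rewrite G2 H1 phi_N opprK phi_partial_denominator.
split; first exact: IH1.
rewrite H_rec (G_rec k.+1) phi_D phi_N phi_M.
by rewrite phi_partial_denominator IH0 IH1 opprD mulrN.
Qed.

Lemma phi_C (c : int) : phi c%:MP = c%:MP.
Proof.
rewrite /phi mmapC /= -{2}[c]intz.
by rewrite (rmorph_int (@mkmalgU monomial int mone)).
Qed.

Lemma phi_V_sum (k : int) :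
  \sum_(m \in V k `&` [set m | (1 < last 0 (mindex m))%N])
    (-1) ^+ g k m *: phi << m >>
  = phi (V_sum k).
Proof.
have -> : V k `&` [set m | (1 < last 0 (mindex m))%N] = V k.
  by apply/setIidl => m; apply: V_gt1.
rewrite /V_sum (raddf_fsum phi); last exact: finite_V.
apply: eq_fsbigr => m _; rewrite -signr_odd !scaler_sign.
by case: odd => //=; rewrite phi_N.
Qed.

(** [X] and [Y] stand for the two sums in the formula for H_k, which [phi_V_sum]
    identifies. *)
Lemma denominator_sumE (R : realType) (k : nat) (X Y : ncpoly) :
  X = phi (V_sum k%:Z) -> Y = phi (V_sum (k%:Z + 1)) ->
  H k = (sigma R k.+1)%:MP - X - Y.
Proof.
have -> : k%:Z + 1 = k.+1%:Z by lia.
move=> -> ->; rewrite denominatorE (numeratorE R).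
have -> : k.+1%:Z - 1 = k%:Z by lia.
rewrite phi_D phi_D phi_N !opprD opprK.
by rewrite phi_C.
Qed.

Theorem corollary20 (R : realType) (k : nat) :
  G k = - (sigma R k)%:MP
        + \sum_(m \in V (k%:Z - 1)) (-1) ^+ g (k%:Z - 1) m *: (<< m >> : ncpoly)
        + \sum_(m \in V k%:Z) (-1) ^+ g k%:Z m *: (<< m >> : ncpoly)
  /\
  H k = (sigma R k.+1)%:MP
        - \sum_(m \in V k%:Z `&` [set m | (1 < last 0 (mindex m))%N])
            (-1) ^+ g k%:Z m *: phi << m >>
        - \sum_(m \in V (k%:Z + 1) `&` [set m | (1 < last 0 (mindex m))%N])
            (-1) ^+ g (k%:Z + 1) m *: phi << m >>.
Proof.
split; first exact: numeratorE.
by apply: denominator_sumE; rewrite phi_V_sum.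
Qed.
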